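(* Let $n,\delta\in\mathbb{N}$ with $\delta\ge3$. If $G$ is a connected $C_4$-free graph of order $n$ and minimum degree $\delta$, then \[\rho(G)\le \frac52\left\lfloor\frac{n}{\delta^2-2\lfloor\delta/2\rfloor+1}\right\rfloor+2.\]
   Context: $C_4$-free means containing no 4-cycle as a subgraph. For a connected graph $G$ of order $n\ge2$ and vertex $v$, $\overline{\sigma}(v)=\frac{1}{n-1}\sum_{w}d(v,w)$; the remoteness is $\rho(G)=\max_v\overline{\sigma}(v)$. *)

(* Defs.v *)
From mathcomp Require Import all_boot all_order all_algebra.

Set Implicit Arguments.
Unset Strict Implicit.
Unset Printing Implicit Defensive.

Import Order.TTheory GRing.Theory Num.Theory.

(* A finite simple graph is a symmetric and irreflexive relation e on a finite
   type T of vertices. *)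

Section Graph.

Variables (T : finType) (e : rel T).

Definition simple_graph : Prop := symmetric e /\ irreflexive e.

Definition connected_graph : Prop := 0 < #|T| /\ forall x y, connect e x y.

(* Not necessarily induced 4-cycles: chords are allowed. *)
Definition C4_free : Prop := ~ exists c : seq T, size c = 4 /\ ucycle e c.

Definition degree (x : T) : nat := #|[set y | e x y]|.

(* The default value #|T| of the minimum exceeds every degree, hence is only
   reached when T is empty. *)
Definition min_degree : nat := \big[minn/#|T|]_(x : T) degree x.

Definition has_walk (x y : T) (k : nat) : bool :=
  [exists p : k.-tuple T, path e x p && (last x p == y)].

(* The least k < #|T| such that y is reached from x by k edges; a shortest path
   has no repeated vertex, so the bound on k loses nothing. The value is #|T|
   when y is not reachable from x. *)
Definition dist (x y : T) : nat := find (has_walk x y) (iota 0 #|T|).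

Definition avg_dist (x : T) : rat :=
  ((\sum_(y : T) dist x y)%N%:R / (#|T| - 1)%N%:R)%R.

(* Average distances are nonnegative, so the default value 0 is harmless. *)
Definition remoteness : rat := \big[Num.max/0%R]_(x : T) avg_dist x.

End Graph.

(* Main.v *)
(** Let [D] be the degree of [u].  In a C4-free graph every vertex other than
    [u] has at most one neighbour in N(u).  Counting the edges leaving N(u), and
    using that the edges inside N(u) form a matching, the ball of radius 2
    about [u] has at least 1 + D delta - 2 floor(D/2) >= M vertices, where
    M = delta^2 - 2 floor(delta/2) + 1.

    Fix [v], let [ecc] be its eccentricity and k = floor(ecc/5).  For every
    j <= k there is a vertex at distance 5j from [v], so at least M vertices lie
    at a distance between 5j-2 and 5j+2; all distances are at most 5k+4.  Hence
    the sum of the distances is at most that of a configuration with M vertices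
    at each distance 5j+2 and the remaining ones at distance 5k+4.  Comparing
    it with (n-1)(5 floor(n/M)/2 + 2) is elementary. *)

Require Import Defs.
From mathcomp Require Import all_boot all_order all_algebra.
From mathcomp Require Import zify lra.

Set Implicit Arguments.
Unset Strict Implicit.
Unset Printing Implicit Defensive.

Import Order.TTheory GRing.Theory Num.Theory.

(** * Distances as lengths of shortest walks *)

Section Distance.

Variables (T : finType) (e : rel T).

Lemma has_walkP x y k :
  reflect (exists p, [/\ size p = k, path e x p & last x p = y])
          (has_walk e x y k).
Proof.
apply: (iffP existsP) => [[p /andP[ep /eqP lp]]|[p [sp ep lp]]].
  by exists p; rewrite size_tuple.
have sp' : size p == k by apply/eqP.
by exists (Tuple sp'); rewrite /= ep lp eqxx.
Qed.

Lemma dist_le_walk x y k : has_walk e x y k -> dist e x y <= k.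
Proof.
move=> walk_k; rewrite /dist; case: (ltnP k #|T|) => [lt_k|le_k].
  rewrite leqNgt; apply/negP => /(before_find 0).
  by rewrite nth_iota // add0n walk_k.
(* Here k >= #|T|, and [find] never exceeds the length #|T| of the list. *)
by apply: leq_trans le_k; rewrite -[leqRHS](size_iota 0) find_size.
Qed.

(** Shortening a walk to one without repeated vertices brings its length below #|T|, so the search
    defining [dist] succeeds. *)
Lemma dist_walk x y : connect e x y -> has_walk e x y (dist e x y).
Proof.
case/connectP=> p0 ep0 ->; case/shortenP: ep0 => p ep up _.
have lt_p : size p < #|T|.
  by have := max_card (mem (x :: p)); rewrite (card_uniqP up).
have hasw : has (has_walk e x (last x p)) (iota 0 #|T|).
  apply/hasP; exists (size p); first by rewrite mem_iota.
  by apply/has_walkP; exists p.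
have := nth_find 0 hasw; rewrite nth_iota //.
by rewrite -[ltnRHS](size_iota 0) -has_find.
Qed.

Hypothesis connG : forall x y, connect e x y.

Lemma dist_triangle x y z : dist e x z <= dist e x y + dist e y z.
Proof.
have /has_walkP[p [sp ep lp]] := dist_walk (connG x y).
have /has_walkP[q [sq eq lq]] := dist_walk (connG y z).
apply: dist_le_walk; apply/has_walkP; exists (p ++ q).
by rewrite size_cat sp sq cat_path last_cat ep lp eq lq.
Qed.

(** Cut a shortest walk after k edges: by the triangle inequality the first piece cannot be
    shortened. *)
Lemma dist_intermediate x y k :
  k <= dist e x y -> exists z, dist e x z = k.
Proof.
move=> le_k; have /has_walkP[p [sp ep lp]] := dist_walk (connG x y).
have le_kp : k <= size p by rewrite sp.
rewrite -(cat_take_drop k p) cat_path last_cat in ep lp.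
case/andP: ep => ep1 ep2; set z := last x (take k p) in ep2 lp.
have d1 : dist e x z <= k.
  by apply/dist_le_walk/has_walkP; exists (take k p); rewrite size_takel.
have d2 : dist e z y <= size p - k.
  by apply/dist_le_walk/has_walkP; exists (drop k p); rewrite size_drop.
by exists z; have := dist_triangle x z y; lia.
Qed.

Lemma dist_sym x y : symmetric e -> dist e x y = dist e y x.
Proof.
move=> sym_e; apply: eq_find => k.
suff imp a b : has_walk e a b k -> has_walk e b a k by apply/idP/idP; apply: imp.
case/has_walkP=> p [sp ep lp]; apply/has_walkP; exists (rev (belast a p)).
rewrite size_rev size_belast -[in path _ _ _]lp rev_path; split => //.
  by rewrite (eq_path (e' := e)) // => u w; rewrite sym_e.
by case: p {sp ep} lp => [|c p] //=; rewrite rev_cons last_rcons.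
Qed.

Lemma min_degree_le x : min_degree e <= degree e x.
Proof.
rewrite /min_degree; elim: (index_enum T) (mem_index_enum x) => // y s IHs.
rewrite inE big_cons => /predU1P[<-|/IHs]; first exact: geq_minl.
by apply: leq_trans; apply: geq_minr.
Qed.

End Distance.

(** Partners are unique, so the reflexive closure of r is an equivalence on S, and all its classes
    have two elements. *)
Lemma card_perfect_matching (T : finType) (r : rel T) (S : {set T}) :
    symmetric r -> irreflexive r ->
    {in S, forall x, #|[set y in S | r x y]| = 1} ->
  ~~ odd #|S|.
Proof.
move=> sym_r irr_r deg1.
have uniq_r x y z : x \in S -> y \in S -> z \in S -> r x y -> r x z -> y = z.
  move=> xS yS zS rxy rxz; have /eqP/cards1P[w Ew] := deg1 _ xS.
  have /[!Ew] /set1P-> : y \in [set t in S | r x t] by rewrite inE yS.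
  by have /[!Ew] /set1P-> : z \in [set t in S | r x t] by rewrite inE zS.
pose R := [rel x y | (x == y) || r x y].
have eqR : {in S & &, equivalence_rel R}.
  move=> x y z xS yS zS; rewrite /= eqxx; split=> //.
  case/predU1P=> [->//|rxy]; have ryx : r y x by rewrite sym_r.
  apply/idP/idP=> /predU1P[].
  - by move=> <-; rewrite ryx orbT.
  - by move/(uniq_r _ _ _ xS yS zS rxy)->; rewrite eqxx.
  - by move=> <-; rewrite rxy orbT.
  - by move/(uniq_r _ _ _ yS xS zS ryx)->; rewrite eqxx.
have partS := equivalence_partitionP eqR.
rewrite (card_uniform_partition (n := 2) _ partS) ?oddM ?andbF // => B.
case/imsetP=> x xS ->.
have -> : [set y in S | R x y] = x |: [set y in S | r x y].
  by apply/setP=> y; rewrite !inE eq_sym; case: eqP => [->|] /=; rewrite ?xS.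
by rewrite cardsU1 deg1 // inE irr_r andbF.
Qed.

(** * Balls of radius 2 in C4-free graphs *)

Section C4Free.

Variables (T : finType) (e : rel T).
Hypotheses (simpleG : simple_graph e) (C4G : C4_free e).

Let sym_e : symmetric e := simpleG.1.
Let irr_e : irreflexive e := simpleG.2.

Lemma C4_free_common x y a b :
  x != y -> e x a -> e y a -> e x b -> e y b -> a = b.
Proof.
have neq z t : e z t -> z != t by apply: contraTneq => ->; rewrite irr_e.
move=> xy xa ya xb yb; apply/eqP/contraT => ab; case: C4G.
exists [:: x; a; y; b]; split=> //; rewrite /ucycle /= !inE xa yb.
rewrite (sym_e a) ya (sym_e b) xb !negb_or (neq _ _ xa) xy (neq _ _ xb) ab.
by rewrite (neq _ _ yb) eq_sym (neq _ _ ya).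
Qed.

Let nbh u := [set y | e u y].

Lemma C4_free_card_common u w : w != u -> #|[set a in nbh u | e w a]| <= 1.
Proof.
move=> wu; apply/card_le1_eqP => a b; rewrite !inE.
move=> /andP[ua wa] /andP[ub wb].
by apply: (@C4_free_common w u).
Qed.

Let matched u := [set a in nbh u | [exists b in nbh u, e a b]].

(** A vertex a of N(u) shares at most one neighbour with u, so the edges inside N(u) match the
    vertices they cover perfectly. *)
Lemma C4_free_matched_even u : ~~ odd #|matched u|.
Proof.
apply: (card_perfect_matching sym_e irr_e) => a.
rewrite inE => /andP[ua /exists_inP[b ub ab]].
have /C4_free_card_common le1 : a != u.
  by apply: contraTneq ua => ->; rewrite inE irr_e.
apply/eqP; rewrite eqn_leq (leq_trans _ le1) /=; last first.
  by apply/subset_leq_card/subsetP => y; rewrite !inE => /andP[/andP[-> _] ->].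
apply/card_gt0P; exists b; rewrite !inE ab andbT.
move: ub ua; rewrite !inE => -> ua.
by apply/exists_inP; exists a; rewrite ?inE // sym_e.
Qed.

(** The sum is at most the size of [matched u], an even number not exceeding the degree of u. *)
Lemma C4_free_sum_inner_degree u :
  \sum_(a in nbh u) #|[set b in nbh u | e a b]| <= 2 * (degree e u)./2.
Proof.
have le_m : #|matched u| <= degree e u.
  by apply/subset_leq_card/subsetP => y /setIdP[].
have odd_m := C4_free_matched_even u.
apply: (@leq_trans #|matched u|); last first.
  by rewrite -(odd_double_half #|_|) (negPf odd_m) add0n -mul2n leq_mul ?half_leq.
rewrite -sum1_card [leqRHS]big_mkcond [leqLHS]big_mkcond; apply: leq_sum => a _.
rewrite [a \in matched u]inE; case ua: (a \in nbh u) => //=.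
case: exists_inP => [_|nex].
  apply: C4_free_card_common; apply: contraTneq ua => ->.
  by rewrite inE irr_e.
rewrite leqn0 cards_eq0; apply/eqP/setP => b; rewrite !inE; apply/negP.
by case/andP=> ub ab; case: nex; exists b; rewrite ?inE.
Qed.

Lemma C4_free_card_ball2_degree u d :
    (forall x, d <= degree e x) ->
  degree e u * d + 1 <= #|[set w | dist e u w <= 2]| + 2 * (degree e u)./2.
Proof.
move=> deg_ge; set B := [set w | _].
have walkB w p : path e u p -> size p <= 2 -> last u p = w -> w \in B.
  move=> ep sp lp; rewrite inE; apply: leq_trans sp.
  by apply/dist_le_walk/has_walkP; exists p.
have uB : u \in B by apply: (walkB _ [::]).
have NB : nbh u \subset B.
  by apply/subsetP => a; rewrite inE => ua; apply: (walkB _ [:: a]); rewrite //= ua.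
have uN : u \notin nbh u by rewrite inE irr_e.
(* The vertices at distance exactly 2 from u. *)
pose Q := B :\: (u |: nbh u).
have cardB : #|B| = 1 + degree e u + #|Q|.
  have sub : u |: nbh u \subset B by rewrite subUset sub1set uB.
  by rewrite -(cardsID (u |: nbh u) B) (setIidPr sub) cardsU1 uN.
(* A neighbour of a is u itself, or lies in N(u), or lies in Q. *)
have degQ a : a \in nbh u ->
    d <= 1 + #|[set b in nbh u | e a b]| + \sum_(w in Q) e a w.
  move=> ua; apply: leq_trans (deg_ge a) _.
  have -> : \sum_(w in Q) e a w = #|[set w in Q | e a w]|.
    rewrite -sum1_card big_mkcond [RHS]big_mkcond; apply: eq_bigr => w _.
    by rewrite !inE; case: (e a w); rewrite ?andbT ?andbF //; case: ifP.
  have -> : 1 = #|[set u]| by rewrite cards1.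
  apply: leq_trans (leq_add (leq_card_setU _ _) (leqnn _)).
  apply: leq_trans (leq_card_setU _ _); apply/subset_leq_card/subsetP => w.
  rewrite inE in ua; rewrite !inE => aw; rewrite aw !andbT.
  have -> /= : dist e u w <= 2.
    by have := walkB w [:: a; w]; rewrite inE; apply; rewrite //= ua aw.
  by case: (w == u); case: (e u w).
(* Count the edges between N(u) and Q from the side of Q, where each vertex has at most one. *)
have sumQ : \sum_(a in nbh u) \sum_(w in Q) e a w <= #|Q|.
  rewrite exchange_big -sum1_card; apply: leq_sum => w wQ.
  have wu : w != u by move: wQ; rewrite !inE; case: (w == u).
  apply: leq_trans (C4_free_card_common wu); rewrite -sum1_card.
  rewrite big_mkcond [leqRHS]big_mkcond; apply: leq_sum => a _.
  by rewrite !inE (sym_e w); case: (e u a); case: (e a w).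
have := leq_sum (index_enum T) degQ; rewrite !big_split /= !sum_nat_const.
have := C4_free_sum_inner_degree u; rewrite cardB.
have -> : #|nbh u| = degree e u by [].
by lia.
Qed.

Lemma C4_free_card_ball2 u d :
    1 < d -> (forall x, d <= degree e x) ->
  d ^ 2 - 2 * (d %/ 2) + 1 <= #|[set w | dist e u w <= 2]|.
Proof.
move=> d1 deg_ge; have := C4_free_card_ball2_degree u deg_ge.
have := deg_ge u; rewrite leq_eqVlt divn2 -mulnn.
case/predU1P=> [eq_d|].
  by have := leq_pmulr d (ltnW d1); rewrite -eq_d; lia.
(* Since 2 floor(D/2) <= D, the ball has at least D(d-1) + 1 >= (d+1)(d-1) + 1 = d^2 vertices, which
   suffices as floor(d/2) >= 1. *)
move: (degree e u) => D ltdD.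
have : d.+1 * d.-1 <= D * d.-1 by rewrite leq_mul2r ltdD orbT.
case: d {deg_ge ltdD} d1 => // d d1; rewrite /= !mulnS !mulSn.
lia.
Qed.

End C4Free.

(** * Counting by blocks of distances *)

Lemma leq_sum_fibers (T : finType) (b g : T -> nat) m :
  \sum_(j < m) \sum_(w | b w == j) g w <= \sum_w g w.
Proof.
rewrite (eq_bigr (fun j : 'I_m => \sum_w if b w == j then g w else 0)); last first.
  by move=> j _; rewrite big_mkcond.
rewrite exchange_big; apply: leq_sum => w _; rewrite -big_mkcond /=.
case: (ltnP (b w) m) => [lt_bm|le_mb].
  by rewrite (eq_bigl (pred1 (Ordinal lt_bm))) ?big_pred1_eq.
by rewrite big_pred0 // => j; apply/negP => /eqP E; have := ltn_ord j; lia.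
Qed.

Lemma leq_double_sum_levels (n M k s : nat) :
    2 <= M -> k.+1 * M <= n ->
    2 * s + M * k.+1 * (5 * k + 4) <= 2 * (n * (5 * k + 4)) ->
  2 * s <= (n - 1) * (5 * (n %/ M) + 4).
Proof.
move=> M2 le_kn le_s; have M0 : 0 < M by lia.
have le_kq : k < n %/ M by rewrite leq_divRL.
have En := divn_eq n M; have lt_y := ltn_pmod n M0.
move: (n %/ M) (n %% M) le_kq lt_y En => q y le_kq lt_y En.
(* These substitutions remove division and most subtractions. With the largest s allowed, right side
   minus left side is 5(k+1)z + 5m(m+1)M + mM + (5m+6)y - 5m - 4, nonnegative because M >= 2 gives y
   + z >= 1. *)
have [m Em] : exists m, q = k.+1 + m by exists (q - k.+1); lia.
subst q; have [z Ez] : exists z, M = y + z.+1 by exists (M - y.+1); lia.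
subst n M; clear le_kq le_kn lt_y M0.
nia.
Qed.

Section Remoteness.

Variables (T : finType) (e : rel T).
Hypotheses (simpleG : simple_graph e) (connG : connected_graph e).

Lemma sum_dist_le v M :
    2 <= M -> (forall u, M <= #|[set w | dist e u w <= 2]|) ->
  2 * \sum_w dist e v w <= (#|T| - 1) * (5 * (#|T| %/ M) + 4).
Proof.
move=> M2 ball_ge; have conn := connG.2.
pose ecc := \max_w dist e v w; pose k := ecc %/ 5.
have dist_ecc w : dist e v w <= ecc by apply: leq_bigmax.
have dist_k w : dist e v w <= 5 * k + 4 by have := dist_ecc w; lia.
have [y ecc_y] : exists y, ecc = dist e v y.
  by have [y] := bigop.eq_bigmax (dist e v) connG.1; exists y.
(* Rounding the distance to the nearest multiple of 5: block j holds the distances from 5j-2 to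
   5j+2, hence the ball of radius 2 about any vertex at distance 5j. *)
pose b w := (dist e v w + 2) %/ 5.
have block_ge (j : 'I_k.+1) : M <= \sum_(w | b w == j) 1.
  have [u du] : exists u, dist e v u = 5 * j.
    apply: (dist_intermediate conn (y := y)); rewrite -ecc_y.
    by have := ltn_ord j; lia.
  apply: leq_trans (ball_ge u) _; rewrite -sum1dep_card.
  rewrite big_mkcond [leqRHS]big_mkcond; apply: leq_sum => w _.
  case: ifP => // duw; suff -> : b w == j by [].
  have := dist_triangle conn v u w; have := dist_triangle conn v w u.
  by rewrite (dist_sym w u simpleG.1) /b; lia.
apply: (@leq_double_sum_levels _ _ k) => //.
  have := leq_sum_fibers b (fun=> 1) k.+1; rewrite sum1_card; apply: leq_trans.
  by rewrite -[k.+1 in leqLHS]card_ord -sum_nat_const; apply: leq_sum.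
(* The slack of w below the maximal value 5k+4; in block j it is at least 5(k-j) + 2. *)
pose g w := 5 * k + 4 - dist e v w.
have sum_g : \sum_w dist e v w + \sum_w g w = #|T| * (5 * k + 4).
  by rewrite -big_split -sum_nat_const; apply: eq_bigr => w _; rewrite /g /= subnKC.
suff: M * k.+1 * (5 * k + 4) <= 2 * \sum_w g w by lia.
(* Reversing the order of summation turns the right side into an arithmetic progression. *)
have -> : M * k.+1 * (5 * k + 4) = 2 * \sum_(j < k.+1) M * (5 * (k - j) + 2).
  rewrite -big_distrr /= -(big_mkord xpredT (fun j => 5 * (k - j) + 2)).
  rewrite big_nat_rev /= add0n.
  rewrite (eq_big_nat _ _ (F2 := fun j => 5 * j + 2)) => [|j ltj]; last by lia.
  elim: (k) => [|i IHi]; first by rewrite big_nat1; lia.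
  by rewrite big_nat_recr //=; nia.
rewrite leq_mul2l /=; apply: leq_trans (leq_sum_fibers b g k.+1).
apply: leq_sum => j _.
apply: (@leq_trans (\sum_(w | b w == j) 1 * (5 * (k - j) + 2))).
  by rewrite -big_distrl leq_mul2r block_ge orbT.
apply: leq_sum => w /eqP bw; have := ltn_ord j.
by rewrite /g -bw /b; lia.
Qed.

End Remoteness.

Theorem theorem5p5 (n delta : nat) (hdelta : 3 <= delta)
    (T : finType) (e : rel T) (hG : simple_graph e) (hconn : connected_graph e)
    (hC4 : C4_free e) (hn : #|T| = n) (hmin : min_degree e = delta) :
  (remoteness e <=
   5%:R / 2%:R * (n %/ (delta ^ 2 - 2 * (delta %/ 2) + 1))%N%:R + 2%:R)%R.
Proof.
have deg_ge x : delta <= degree e x by rewrite -hmin min_degree_le.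
have ball_ge u := C4_free_card_ball2 hG hC4 u (ltnW hdelta) deg_ge.
set M := (_ + 1)%N in ball_ge *; have M2 : 2 <= M by rewrite /M; nia.
rewrite /remoteness; set bnd := (_ + 2%:R)%R.
have bnd0 : (0 <= bnd)%R by rewrite addr_ge0 ?mulr_ge0 ?ler0n.
apply: (big_ind (fun r => (r <= bnd)%R)) => // [r1 r2 le1 le2|v _].
  by rewrite ge_max le1.
have := sum_dist_le hG hconn v M2 ball_ge; rewrite /avg_dist /bnd hn.
(* For a single vertex, division by zero makes the average distance 0. *)
have [-> _|n1 le_s] := posnP (n - 1); first by rewrite invr0 mulr0.
rewrite ler_pdivrMr ?ltr0n //.
move: le_s; rewrite -(ler_nat rat) !(natrM, natrD).
by lra.
Qed.
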